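(* Let $N$ be a positive integer, let $t_{\min}\le t_{\max}$ be real numbers, and let $C_N:[t_{\min},t_{\max}]\to\mathbb{R}^N$ be given by $C_N(t)=(t,t^2,t^3,\dots,t^N)$. Then every point in the convex hull of the image of $C_N$ can be represented as a convex combination of at most $\frac{N+1}{2}$ points on this curve if $N$ is odd, or as a convex combination of at most $\frac{N+2}{2}$ points on this curve if $N$ is even. Furthermore, if $N$ is even, one of these at most $\frac{N+2}{2}$ points on the curve can be required to be the point $C_N(t_{\min})$.
   Context: A convex combination is a finite sum $\sum_j c_j p_j$ with $c_j\ge 0$ and $\sum_j c_j=1$; coefficients are allowed to be zero (in particular, the coefficient of the required point $C_N(t_{\min})$ may be $0$). *)

(* Defs.v *)
From mathcomp Require Import all_boot all_order all_algebra.
From mathcomp Require Import boolp classical_sets set_interval reals.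

Set Implicit Arguments.
Unset Strict Implicit.
Unset Printing Implicit Defensive.

Import Order.TTheory GRing.Theory Num.Theory.
Local Open Scope classical_set_scope.
Local Open Scope ring_scope.

(* The family p may repeat points and the coefficients c may vanish. *)
Definition convex_comb (R : realType) (V : lmodType R) (k : nat)
    (c : 'I_k -> R) (p : 'I_k -> V) (x : V) : Prop :=
  [/\ forall j, 0 <= c j, \sum_(j < k) c j = 1 & x = \sum_(j < k) c j *: p j].

Definition convex_hull (R : realType) (V : lmodType R) (A : set V) : set V :=
  [set x | exists (k : nat) (c : 'I_k -> R) (p : 'I_k -> V),
     (forall j, A (p j)) /\ convex_comb c p x].

(* The coordinate of index i (counted from 0) is t ^+ i.+1, so that the point
   is (t, t^2, ..., t^N). *)
Definition moment_curve (R : realType) (N : nat) (t : R) : 'rV[R]_N :=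
  \row_(i < N) t ^+ i.+1.

Definition moment_arc (R : realType) (N : nat) (tmin tmax : R) : set 'rV[R]_N :=
  moment_curve N @` `[tmin, tmax].
Arguments moment_arc {R} N tmin tmax _.

(* Main.v *)
Require Import Defs.
From mathcomp Require Import all_boot all_order all_algebra.
From mathcomp Require Import boolp classical_sets set_interval reals.
From mathcomp Require Import polyrcf ring.

(** A point of the hull is the moment vector of a finitely supported
    probability measure on [tmin, tmax], so a shorter convex combination is a
    quadrature rule with nonnegative weights that is exact up to degree N. For
    N = 2m - 1 this is Gauss quadrature: a nonzero p of degree at most m,
    orthogonal to all polynomials of degree < m, has m distinct zeros in the
    open interval, which serve as nodes, unless the measure is supported on
    the zeros of p. For N = 2m it is Gauss-Radau quadrature with the fixed node
    tmin, obtained from the Gauss rule of the measure weighted by t - tmin. *)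

Import Order.TTheory GRing.Theory Num.Theory.
Local Open Scope classical_set_scope.
Local Open Scope ring_scope.

(* Constancy of sign is expressed by nonnegativity of the products [g u * g v].
   The nodes are the roots of odd multiplicity. *)
Lemma constant_sign_nodes (R : rcfType) (a b : R) (p : {poly R}) : p != 0 ->
  exists s : seq R, let g := p * \prod_(y <- s) ('X - y%:P) in
    [/\ uniq s, all (root p) s, {in s, forall y, y \in `]a, b[}
      & {in `[a, b] &, forall u v, 0 <= g.[u] * g.[v]}].
Proof.
have [n] := ubnP (size p); elim: n p => // n IHn p le_p p0.
case: (pselect (exists2 y, y \in `]a, b[ & root p y)) => [[y yab py]|noroot].
  have [q pq] := factor_theorem _ _ py.
  have q0 : q != 0 by apply: contraNneq p0 => q0; rewrite pq q0 mul0r.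
  have le_q : (size q < n)%N.
    by move: le_p; rewrite pq size_Mmonic ?monicXsubC// size_XsubC addn2 ltnS.
  have [s /= [Us sq sab gs]] := IHn _ le_q q0.
  have ps : all (root p) s.
    by apply/allP => z /(allP sq); rewrite pq rootM => ->.
  (* The extra factor ['X - y%:P] flips the parity of the multiplicity of [y], so [y] joins the
     nodes of [q] or leaves them. *)
  have [ys|ys] := boolP (y \in s); last first.
    exists (y :: s) => /=; split => //; first by rewrite ys.
    - by rewrite py.
    - by move=> z; rewrite inE => /orP[/eqP->//|/sab].
    move=> u v uab vab; rewrite pq big_cons !hornerM !hornerXsubC.
    have := gs _ _ uab vab; rewrite !hornerM.
    set A := (_ * _ * _) => A0.
    have -> : forall q1 q2 p1 p2 : R,
      q1 * (u - y) * ((u - y) * p1) * (q2 * (v - y) * ((v - y) * p2)) =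
      ((u - y) * (v - y)) ^+ 2 * (q1 * p1 * (q2 * p2)) by move=> *; ring.
    by rewrite mulr_ge0 ?sqr_ge0.
  exists (rem y s) => /=; split.
  - exact: rem_uniq.
  - by apply/allP => z /mem_rem /(allP ps).
  - by move=> z /mem_rem /sab.
  move=> u v uab vab; have := gs _ _ uab vab.
  by rewrite pq (big_rem _ ys) /= mulrA.
exists [::]; split => //= u v uab vab; rewrite big_nil mulr1.
wlog le_uv : u v uab vab / u <= v.
  by move=> W; have [/W|/ltW/W] := leP u v; [|rewrite mulrC]; apply.
(* Strictly opposite signs force a root strictly between [u] and [v], hence in the open interval
   even if these are its endpoints. *)
rewrite leNgt; apply/negP => /(poly_ivtoo le_uv)[y yuv py]; apply: noroot.
exists y => //; move: yuv uab vab; rewrite !in_itv /= => /andP[uy yv].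
by move=> /andP[au _] /andP[_ vb]; rewrite (le_lt_trans au uy) (lt_le_trans yv vb).
Qed.

(** [A] is the Hankel matrix of moments: if the row [u] lists the coefficients of [p], entry [i] of
    [u *m A] is the functional at [p * 'X^i]. With [m.+1] rows and [m] columns, [A] has a nonzero
    left kernel. *)
Lemma exists_orthogonal_poly (R : fieldType) (k m : nat) (c t : 'I_k -> R) :
  exists p : {poly R}, [/\ p != 0, (size p <= m.+1)%N &
    forall q : {poly R}, (size q <= m)%N ->
      \sum_(j < k) c j * (p * q).[t j] = 0].
Proof.
pose A := \matrix_(l < m.+1, i < m) \sum_(j < k) c j * t j ^+ (l + i).
have kerA : kermx A != 0.
  by rewrite kermx_eq0 /row_free neq_ltn ltnS rank_leq_col.
pose u := nz_row (kermx A).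
have uA : u *m A = 0 by apply/sub_kermxP/nz_row_sub.
exists (rVpoly u); split.
- apply: contra_neq kerA => pu; apply/eqP; rewrite -nz_row_eq0 -/u.
  by rewrite -(rVpolyK u) pu linear0.
- exact: size_poly.
move=> q szq.
transitivity (\sum_(i < m) q`_i * (u *m A) 0 i); last first.
  by rewrite uA big1 // => i _; rewrite mxE mulr0.
under [RHS]eq_bigr => i _.
  rewrite mxE; under eq_bigr => l _ do rewrite mxE mulr_sumr.
  rewrite exchange_big mulr_sumr.
  over.
rewrite exchange_big; apply: eq_bigr => j _ /=.
rewrite hornerM (horner_coef_wide _ szq).
rewrite (horner_coef_wide _ (size_poly _ _)) !mulr_sumr; apply: eq_bigr => i _.
rewrite mulr_suml !mulr_sumr; apply: eq_bigr => l _.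
by rewrite coef_rVpoly_ord exprD; ring.
Qed.

(** These polynomials recover a remainder from its values at the nodes, and their squares show that
    the Gauss weights are nonnegative. *)
Lemma lagrange_node_polys (R : fieldType) (s : seq R) : uniq s ->
  exists l : R -> {poly R}, {in s, forall y,
    (size (l y) <= size s)%N /\ {in s, forall z, (l y).[z] = (z == y)%:R}}.
Proof.
move=> Us.
pose P y := \prod_(z <- rem y s) ('X - z%:P).
exists (fun y => (P y).[y]^-1 *: P y) => y ys.
have Py z : z \in s -> ((P y).[z] == 0) = (z != y).
  move=> zs; have := root_prod_XsubC (rem y s) z.
  by rewrite rootE mem_rem_uniq // inE zs andbT => ->.
split.
  rewrite (leq_trans (size_scale_leq _ _)) // size_prod_XsubC size_rem //.
  by rewrite prednK // -has_predT; apply/hasP; exists y.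
move=> z zs; rewrite hornerZ; have := Py _ zs.
have [->|_ /eqP->] := eqVneq z y; last by rewrite mulr0.
by move/negbT => ?; rewrite mulVf.
Qed.

(** The clause on nodes is finer than membership in the closed interval: for the weights
    [c j * (t j - a)] of the Radau rule it keeps every node away from [a]. *)
Lemma gauss_quadrature (R : rcfType) (a b : R) (k m : nat) (c t : 'I_k -> R) :
  (forall j, 0 <= c j) -> (forall j, t j \in `[a, b]) ->
  exists (s : seq R) (w : R -> R),
    [/\ (size s <= m)%N,
        {in s, forall y, (y \in `]a, b[) \/ (exists2 j, 0 < c j & y = t j)},
        {in s, forall y, 0 <= w y}
      & forall f : {poly R}, (size f <= m.*2)%N ->
          \sum_(j < k) c j * f.[t j] = \sum_(y <- s) w y * f.[y]].
Proof.
move=> c0 tab.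
have [p [p0 szp pq0]] := exists_orthogonal_poly _ k m c t.
have [s /= [Us ps sab gs]] := constant_sign_nodes _ a b _ p0.
have szs : (size s <= m)%N by rewrite -ltnS (leq_trans (max_poly_roots p0 ps Us)).
have [sm|sm] := ltnP (size s) m.
  (* Here [p * \prod_(y <- s) ('X - y)] has constant sign and integral zero,
     so it vanishes on the support of the measure. *)
  have pt j : 0 < c j -> root p (t j).
    move=> cj; set g := p * _ in gs.
    (* The factor [g.[t j]] makes all summands nonnegative, whichever sign [g] has. As [size s < m],
       the product over [s] is small enough for [pq0]. *)
    have g0 : \sum_(i < k) c i * g.[t i] * g.[t j] = 0.
      by rewrite -mulr_suml pq0 ?mul0r // size_prod_XsubC.
    have /eqP : c j * g.[t j] * g.[t j] = 0.
      apply: (psumr_eq0P _ g0) => // i _.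
      by rewrite -mulrA mulr_ge0 ?c0 ?gs ?tab.
    rewrite !mulf_eq0 gt_eqF //= orbb -/(root _ _) rootM root_prod_XsubC.
    by case/orP => // /(allP ps).
  (* The support consists of roots of [p], so it has at most [m] points; the measure itself, with
     the masses at equal points merged, is the rule. *)
  pose r := undup [seq t j | j <- enum 'I_k & 0 < c j].
  exists r, (fun y => \sum_(j < k | t j == y) c j); split.
  - rewrite -ltnS (leq_trans (max_poly_roots p0 _ (undup_uniq _))) //.
    apply/allP => y; rewrite mem_undup => /mapP[j].
    by rewrite mem_filter => /andP[/pt ? _] ->.
  - move=> y; rewrite mem_undup => /mapP[j].
    by rewrite mem_filter => /andP[cj _] ->; right; exists j.
  - by move=> y _; apply: sumr_ge0.
  move=> f _.
  transitivity (\sum_(y <- r) \sum_(j < k)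
      if t j == y then c j * f.[t j] else 0); last first.
    apply: eq_bigr => y _; rewrite -big_mkcond mulr_suml.
    by apply: eq_bigr => j /eqP ->.
  rewrite exchange_big; apply: eq_bigr => j _ /=.
  have [cj|] := boolP (0 < c j); last first.
    rewrite lt_def c0 andbT negbK => /eqP ->; rewrite mul0r big1 // => y _.
    by case: ifP; rewrite ?mul0r.
  have tr : t j \in r.
    by rewrite mem_undup; apply: map_f; rewrite mem_filter cj mem_enum.
  rewrite (bigD1_seq (t j)) ?undup_uniq //= eqxx big1 ?addr0 // => y yt.
  by rewrite eq_sym (negPf yt).
have {sm szs}sm : size s = m by apply/eqP; rewrite eqn_leq szs.
have [l lP] := lagrange_node_polys _ s Us.
(* Having [m] distinct roots, [p] has degree exactly [m], so dividing [f] by it leaves a quotient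
   and a remainder of size at most [m]. *)
have szp' : size p = m.+1.
  by apply/eqP; rewrite eqn_leq szp -sm max_poly_roots.
(* [f] and its remainder modulo [p] have the same functional value and the
   same values at the nodes. *)
have interp (f : {poly R}) : (size f <= m.*2)%N -> \sum_(j < k) c j * f.[t j] =
    \sum_(y <- s) (\sum_(j < k) c j * (l y).[t j]) * f.[y].
  move=> szf.
  have szr : (size (f %% p)%R <= m)%N by rewrite -ltnS -szp' ltn_modp.
  have szq : (size (f %/ p)%R <= m)%N.
    by rewrite size_divp // szp' leq_subLR addnn.
  have fpE : \sum_(j < k) c j * f.[t j] = \sum_(j < k) c j * (f %% p).[t j].
    under eq_bigr => j _ do rewrite {1}(divp_eq f p) hornerD mulrDr.
    rewrite big_split /=; under eq_bigr do rewrite [_ * p]mulrC.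
    by rewrite pq0 // add0r.
  have fpy y : y \in s -> f.[y] = (f %% p).[y].
    move=> /(allP ps)/eqP py.
    by rewrite {1}(divp_eq f p) hornerD hornerM py mulr0 add0r.
  (* Both sides have size at most [m] and agree at the [m] nodes. *)
  have rE : f %% p = \sum_(y <- s) f.[y] *: l y.
    apply/eqP; rewrite -subr_eq0; apply: contraT => d0.
    suff ds : all (root (f %% p - \sum_(y <- s) f.[y] *: l y)) s.
      have := leq_trans (max_poly_roots d0 ds Us) (size_polyD _ _).
      rewrite size_polyN sm ltnNge geq_max szr /=.
      have -> // : (size (\sum_(y <- s) f.[y] *: l y)%R <= m)%N.
      rewrite big_seq; elim/big_ind: _ => [|q1 q2 h1 h2|y ys].
      - by rewrite size_poly0.
      - by rewrite (leq_trans (size_polyD _ _)) // geq_max h1.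
      by rewrite (leq_trans (size_scale_leq _ _)) // -sm; case: (lP _ ys).
    apply/allP => z zs; rewrite rootE !hornerE horner_sum subr_eq0 -fpy //.
    rewrite (bigD1_seq z) //= hornerZ (lP _ zs).2 // eqxx mulr1.
    rewrite big_seq_cond big1 ?addr0 // => y /andP[ys yz].
    by rewrite hornerZ (lP _ ys).2 // eq_sym (negPf yz) mulr0.
  rewrite fpE rE; under [RHS]eq_bigr do rewrite mulr_suml.
  rewrite exchange_big; apply: eq_bigr => j _ /=.
  rewrite horner_sum mulr_sumr; apply: eq_bigr => y _.
  by rewrite hornerZ; ring.
exists s, (fun y => \sum_(j < k) c j * (l y).[t j]); split=> //.
- by rewrite sm.
- by move=> y /sab; left.
move=> y ys.
(* The weight of [y] is also the functional at the square of [l y]. *)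
have [szl ly] := lP _ ys.
have szl2 : (size (l y ^+ 2) <= m.*2)%N.
  rewrite (leq_trans (size_polyMleq _ _)) //.
  rewrite -subn1 leq_subLR -addnn -sm.
  by rewrite (leq_trans (leq_add szl szl)) // leq_addl.
have := interp _ szl2.
rewrite [X in _ = X -> _](bigD1_seq y) //= horner_exp ly // eqxx expr1n mulr1.
rewrite [X in _ = _ + X -> _]big_seq_cond.
rewrite [X in _ = _ + X -> _]big1 ?addr0 => [<-|z /andP[zs zy]].
  by apply: sumr_ge0 => j _; rewrite horner_exp mulr_ge0 ?sqr_ge0.
by rewrite horner_exp ly // (negPf zy) expr0n mulr0.
Qed.

Lemma gauss_radau_quadrature (R : rcfType) (a b : R) (k m : nat)
    (c t : 'I_k -> R) :
  (forall j, 0 <= c j) -> (forall j, t j \in `[a, b]) ->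
  exists (s : seq R) (w : R -> R),
    [/\ (size s <= m)%N, {in s, forall y, y \in `[a, b]},
        {in a :: s, forall y, 0 <= w y}
      & forall f : {poly R}, (size f <= m.*2.+1)%N ->
          \sum_(j < k) c j * f.[t j] = \sum_(y <- a :: s) w y * f.[y]].
Proof.
move=> c0 tab.
have ta0 j : 0 <= t j - a.
  by have := tab j; rewrite in_itv /= subr_ge0 => /andP[].
have [j|s [w [szs sab w0 wE]]] :=
  gauss_quadrature _ a b k m (fun j => c j * (t j - a)) t _ tab.
  by rewrite mulr_ge0.
(* A node taken from the support carries positive weighted mass [c j * (t j - a)], which excludes
   [t j = a]. *)
have {}sab y : y \in s -> a < y <= b.
  case/sab => [|[j cj ->]]; first by rewrite in_itv /= => /andP[-> /ltW].
  have := tab j; rewrite in_itv /= => /andP[_ ->]; rewrite andbT -subr_gt0.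
  rewrite lt_def ta0 andbT; apply: contraTneq cj => ->.
  by rewrite mulr0 ltxx.
have ya y : y \in s -> 0 < y - a by rewrite subr_gt0 => /sab/andP[].
have as' : a \notin s by apply/negP => /sab; rewrite ltxx.
(* Writing [f] as [f.[a]] plus [q] times ['X - a%:P], the Gauss rule is applied to [q]. Division by
   [y - a] undoes the weighting, and the mass still missing is put at [a], which makes the rule
   exact on constants. *)
pose w1 y := w y / (y - a).
pose w' y := if y == a then \sum_(j < k) c j - \sum_(y <- s) w1 y else w1 y.
have w's f : \sum_(y <- s) w' y * f y = \sum_(y <- s) w1 y * f y.
  rewrite !big_seq; apply: eq_bigr => y ys; rewrite /w'.
  by case: eqP ys => // ->; rewrite (negPf as').
have w'E (f : {poly R}) : (size f <= m.*2.+1)%N ->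
    \sum_(j < k) c j * f.[t j] = \sum_(y <- a :: s) w' y * f.[y].
  move=> szf.
  have /factor_theorem[q fq] : root (f - f.[a]%:P) a.
    by rewrite rootE !hornerE subrr.
  have fE x : f.[x] = f.[a] + q.[x] * (x - a).
    have /(congr1 (fun p : {poly R} => p.[x])) := fq.
    by rewrite !hornerE => <-; ring.
  have szq : (size q <= m.*2)%N.
    have [->|q0] := eqVneq q 0; first by rewrite size_poly0.
    have: (size (f - f.[a]%:P)%R <= m.*2.+1)%N.
      rewrite (leq_trans (size_polyD _ _)) // geq_max szf size_polyN.
      by rewrite (leq_trans (size_polyC_leq1 _)).
    by rewrite fq size_Mmonic ?monicXsubC// size_XsubC addn2.
  rewrite big_cons w's /w' eqxx mulrBl !mulr_suml.
  under eq_bigr => j _ do rewrite fE mulrDr.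
  rewrite big_split /= -addrA; congr (_ + _).
  transitivity (\sum_(j < k) c j * (t j - a) * q.[t j]).
    by apply: eq_bigr => j _; ring.
  rewrite (wE q szq) addrC -sumrB !big_seq; apply: eq_bigr => y ys.
  by rewrite [f.[y]]fE /w1; field; rewrite gt_eqF ?ya.
exists s, w'; split=> //.
  by move=> y /sab/andP[ay yb]; rewrite in_itv /= ltW.
move=> y; rewrite inE => /orP[/eqP ->|ys]; last first.
  rewrite /w'; case: eqP => [ya'|_]; first by rewrite -ya' ys in as'.
  by rewrite divr_ge0 ?w0 ?ltW ?ya.
(* Test on the square vanishing at all nodes but [a]. *)
pose f := (\prod_(y <- s) ('X - y%:P)) ^+ 2.
have fa : 0 < f.[a].
  rewrite hornerE exprn_even_gt0 //= -/(root _ _).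
  by rewrite root_prod_XsubC.
have szf : (size f <= m.*2.+1)%N.
  rewrite (leq_trans (size_polyMleq _ _)) // size_prod_XsubC addnS /= addSn ltnS.
  by rewrite addnn leq_double.
have := w'E f szf; rewrite big_cons.
rewrite [X in _ = _ + X -> _]big_seq [X in _ = _ + X -> _]big1 => [|z zs]; last first.
  suff /eqP -> : f.[z] == 0 by rewrite mulr0.
  by rewrite hornerE expf_eq0 /= -/(root _ _) root_prod_XsubC.
rewrite addr0 -(pmulr_lge0 _ fa) => <-; apply: sumr_ge0 => j _.
by rewrite hornerE mulr_ge0 ?sqr_ge0.
Qed.

(** Exactness at [1] gives total weight one, and exactness at ['X^(i.+1)] gives the coordinate of
    index [i]. *)
Lemma convex_comb_of_quadrature (R : realType) (N : nat) (k : nat)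
    (c t : 'I_k -> R) (s : seq R) (w : R -> R) (x : 'rV[R]_N) :
  convex_comb c (fun j => moment_curve N (t j)) x ->
  {in s, forall y, 0 <= w y} ->
  (forall f : {poly R}, (size f <= N.+1)%N ->
     \sum_(j < k) c j * f.[t j] = \sum_(y <- s) w y * f.[y]) ->
  convex_comb (fun j => w (tnth (in_tuple s) j))
    (fun j => moment_curve N (tnth (in_tuple s) j)) x.
Proof.
move=> [c0 c1 xE] w0 wE; split.
- by move=> j; apply/w0/mem_tnth.
- have := wE 1; rewrite size_poly1 => /(_ isT).
  under eq_bigr do rewrite hornerE mulr1.
  by rewrite c1 big_tnth => ->; apply: eq_bigr => j _; rewrite hornerE mulr1.
rewrite xE; apply/rowP => i; rewrite !summxE.
have := wE 'X^(i.+1); rewrite size_polyXn ltnS => /(_ (ltn_ord i)).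
under eq_bigr => j _ do rewrite hornerXn.
rewrite [X in _ = X -> _]big_tnth => e.
transitivity (\sum_j c j * t j ^+ i.+1); first by apply: eq_bigr => j _; rewrite !mxE.
by rewrite e; apply: eq_bigr => j _; rewrite !mxE hornerXn.
Qed.

Theorem mainTheorem1 (R : realType) (N : nat) (tmin tmax : R)
    (N_gt0 : (0 < N)%N) (tmin_le_tmax : tmin <= tmax)
    (x : 'rV[R]_N) (hull_x : convex_hull (moment_arc N tmin tmax) x) :
  [/\ odd N ->
        exists (k : nat) (c : 'I_k -> R) (p : 'I_k -> 'rV[R]_N),
          [/\ (k <= (N + 1) %/ 2)%N,
              forall j, moment_arc N tmin tmax (p j)
            & convex_comb c p x],
      ~~ odd N ->
        exists (k : nat) (c : 'I_k -> R) (p : 'I_k -> 'rV[R]_N),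
          [/\ (k <= (N + 2) %/ 2)%N,
              forall j, moment_arc N tmin tmax (p j)
            & convex_comb c p x]
    & ~~ odd N ->
        exists (k : nat) (c : 'I_k -> R) (p : 'I_k -> 'rV[R]_N),
          [/\ (k <= (N + 2) %/ 2)%N,
              forall j, moment_arc N tmin tmax (p j),
              exists j, p j = moment_curve N tmin
            & convex_comb c p x]].
Proof.
have {hull_x} [k [c [t [tab xE]]]] : exists k (c t : 'I_k -> R),
    (forall j, t j \in `[tmin, tmax]) /\
    convex_comb c (fun j => moment_curve N (t j)) x.
  have [k [c [p [pA xE]]]] := hull_x.
  exists k, c, (fun j => s2val (cid2 (pA j))); split=> [j|]; first by case: cid2.
  by congr (convex_comb c _ x): xE; apply/funext => j; case: cid2.
have c0 : forall j, 0 <= c j by case: xE.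
have radau : ~~ odd N ->
    exists (k : nat) (c : 'I_k -> R) (p : 'I_k -> 'rV[R]_N),
      [/\ (k <= (N + 2) %/ 2)%N,
          forall j, moment_arc N tmin tmax (p j),
          exists j, p j = moment_curve N tmin
        & convex_comb c p x].
  move=> Neven.
  (* For [N] equal to 2m, the rule has at most m free nodes besides [tmin], and its size bound 2m +
     1 is [N.+1]. *)
  have [s [w [szs sab w0 wE]]] := gauss_radau_quadrature _ _ _ k N./2 c t c0 tab.
  exists (size (tmin :: s)), (fun j => w (tnth (in_tuple (tmin :: s)) j)),
    (fun j => moment_curve N (tnth (in_tuple (tmin :: s)) j)); split.
  - by rewrite divn2 addn2 /= ltnS.
  - move=> j; exists (tnth (in_tuple (tmin :: s)) j) => //.
    have := mem_tnth j (in_tuple (tmin :: s)); rewrite inE => /orP[/eqP->|/sab//].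
    by rewrite /= in_itv /= lexx.
  - by exists ord0.
  by apply: convex_comb_of_quadrature xE w0 _ => f szf; rewrite wE ?even_halfK.
split=> // [Nodd|/radau[k' [c' [p' [? ? _ ?]]]]]; last by exists k', c', p'.
(* For odd [N] the size bound [N.+1] is exactly twice the number of Gauss nodes allowed. *)
have Nm : N.+1 = (N.+1./2).*2 by rewrite even_halfK //= Nodd.
have [s [w [szs sab w0 wE]]] := gauss_quadrature _ _ _ k N.+1./2 c t c0 tab.
exists (size s), (fun j => w (tnth (in_tuple s) j)),
  (fun j => moment_curve N (tnth (in_tuple s) j)); split.
- by rewrite divn2 addn1.
- move=> j; exists (tnth (in_tuple s) j) => //.
  case: (sab _ (mem_tnth j (in_tuple s))) => [|[i _ ->]]; last exact: tab.
  by rewrite /= !in_itv /= => /andP[/ltW-> /ltW->].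
by apply: convex_comb_of_quadrature xE w0 _ => f szf; rewrite wE // -Nm.
Qed.
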